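(* Let $H_1$ and $H_2$ be Hermitian spaces over the same $\ast$-sfield $F$ and let $\phi \colon H_1 \to H_2$ be a linear map. Then $\phi$ is adjointable (as a linear map between Hermitian spaces) if and only if the map $\mathbf P(\phi)\colon \mathbf P(H_1)\to\mathbf P(H_2)$, $\langle u\rangle\mapsto\langle\phi(u)\rangle$, is adjointable (as a map between orthosets).
   Context: A sfield is a skew field (division ring). A $\ast$-sfield is a sfield $F$ with an involutory antiautomorphism $\ast \colon F \to F$. A Hermitian space over a $\ast$-sfield $F$ is a (left) linear space $H$ over $F$ with a map $(\cdot,\cdot)\colon H\times H\to F$ such that $(\alpha u+\beta v,w)=\alpha(u,w)+\beta(v,w)$, $(w,\alpha u+\beta v)=(w,u)\alpha^\ast+(w,v)\beta^\ast$, $(u,v)=(v,u)^\ast$ for all $u,v,w\in H$, $\alpha,\beta\in F$, and which is anisotropic: $(u,u)=0$ implies $u=0$. We write $u\perp v$ if $(u,v)=0$, and for $A\subseteq H$, $A^\perp=\{u\in H: u\perp v\text{ for all }v\in A\}$; a subspace $S$ of $H$ is orthoclosed if $S=S^{\perp\perp}$. Standing assumption: a Hermitian space contains at most countably many mutually orthogonal nonzero vectors. The dual space of $H$ is $H^\ast=\{\rho\colon H\to F : \rho\text{ is linear and }\ker\rho\text{ is orthoclosed}\}$; one has $H^\ast=\{(\cdot,u):u\in H\}$, and $u\mapsto(\cdot,u)$ is a bijection $H\to H^\ast$. A linear map $\phi\colon H_1\to H_2$ between Hermitian spaces over the same $\ast$-sfield is adjointable if $\rho\circ\phi\in H_1^\ast$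 for every $\rho\in H_2^\ast$; equivalently, if there is a map $\phi^\ast\colon H_2\to H_1$ with $(\phi(u),v)=(u,\phi^\ast(v))$ for all $u\in H_1$, $v\in H_2$. An orthoset is a set $X$ with a symmetric binary relation $\perp$ and a constant $0$ such that $x\perp x$ if and only if $x=0$, and $0\perp x$ for all $x\in X$. A map $f\colon X\to Y$ between orthosets is adjointable if there is a map $g\colon Y\to X$ such that for all $x\in X$, $y\in Y$: $f(x)\perp y$ if and only if $x\perp g(y)$. For a Hermitian space $H$, $\mathbf P(H)=\{\langle u\rangle: u\in H\}$ is the set of at most one-dimensional subspaces of $H$ ($\langle u\rangle$ denotes the linear span of $u$), viewed as an orthoset with $\langle u\rangle\perp\langle v\rangle$ if $u\perp v$ and with the zero subspace $\{0\}$ as the constant $0$. *)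

(* Defs.v *)
From HB Require Import structures.
From mathcomp Require Import all_boot all_algebra.
From mathcomp Require Import boolp classical_sets cardinality.

Set Implicit Arguments.
Unset Strict Implicit.
Unset Printing Implicit Defensive.

Import GRing.Theory.

Local Open Scope classical_set_scope.
Local Open Scope ring_scope.

HB.mixin Record IsStarSfield F of GRing.UnitRing F := {
  star : F -> F;
  sfield_unit : forall a : F, a != 0 -> a \is a GRing.unit;
  starD : forall a b : F, star (a + b) = star a + star b;
  starM : forall a b : F, star (a * b) = star b * star a;
  star1 : star 1 = 1;
  starK : forall a : F, star (star a) = a
}.

#[short(type="starSfieldType")]
HB.structure Definition StarSfield := {F of GRing.UnitRing F & IsStarSfield F}.

(* MathComp's sesquilinear forms are twisted by a ring endomorphism of the     *)
(* scalars; over a noncommutative sfield the twist is an antiautomorphism, so  *)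
(* the form is axiomatized directly.                                           *)
HB.mixin Record IsHermitian (F : starSfieldType) H of GRing.Lmodule F H := {
  herm : H -> H -> F;
  hermPl : forall (a b : F) (u v w : H),
    herm (a *: u + b *: v) w = a * herm u w + b * herm v w;
  hermPr : forall (a b : F) (u v w : H),
    herm w (a *: u + b *: v) = herm w u * star a + herm w v * star b;
  hermC : forall u v : H, herm u v = star (herm v u);
  herm_aniso : forall u : H, herm u u = 0 -> u = 0;
  herm_countable : forall A : set H,
    (forall u, A u -> u <> 0) ->
    (forall u v, A u -> A v -> u <> v -> herm u v = 0) ->
    countable A
}.

#[short(type="hermitianSpaceType")]
HB.structure Definition HermitianSpace (F : starSfieldType) :=
  {H of GRing.Lmodule F H & IsHermitian F H}.

HB.mixin Record IsOrthoset X := {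
  orth : X -> X -> Prop;
  orth_zero : X;
  orth_sym : forall x y : X, orth x y -> orth y x;
  orth_self : forall x : X, orth x x <-> x = orth_zero;
  orth0x : forall x : X, orth orth_zero x
}.

#[short(type="orthosetType")]
HB.structure Definition Orthoset := {X of IsOrthoset X}.

Definition orthoset_adjointable (X Y : orthosetType) (f : X -> Y) : Prop :=
  exists g : Y -> X, forall (x : X) (y : Y), orth (f x) y <-> orth x (g y).

Section HermitianTheory.
Variables (F : starSfieldType) (H : hermitianSpaceType F).
Implicit Types (u v : H) (A : set H).

Definition herm_orth u v : Prop := herm u v = 0.

Definition orthocompl A : set H := [set u | forall v, A v -> herm_orth u v].

Definition orthoclosed A : Prop := A = orthocompl (orthocompl A).

Definition dual_space : set (H -> F) :=
  [set rho | scalar rho /\ orthoclosed [set u | rho u = 0]].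

Definition span1 u : set H := [set a *: u | a in [set: F]].

Record proj := Proj {
  proj_set :> set H;
  proj_setP : exists u, proj_set = span1 u
}.

Definition line u : proj := Proj (ex_intro _ u erefl).

Definition proj_orth (p q : proj) : Prop :=
  exists u v, [/\ p = line u, q = line v & herm_orth u v].

Lemma proj_eq (p q : proj) : proj_set p = proj_set q -> p = q.
Proof.
case: p q => [S hS] [T hT] /= eqST; rewrite -eqST in hT *.
by rewrite (Prop_irrelevance hS hT).
Qed.

Lemma projE (p : proj) : exists u, p = line u.
Proof. by case: (proj_setP p) => u hu; exists u; apply: proj_eq. Qed.

Lemma span1_id u : span1 u u.
Proof. by exists 1 => //; rewrite scale1r. Qed.

Lemma line_scale u v : line u = line v -> exists a, u = a *: v.
Proof.
by move=> [uv]; have := span1_id u; rewrite uv => -[a _ <-]; exists a.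
Qed.

Lemma herm0l v : herm (0 : H) v = 0.
Proof. by have := hermPl 0 0 0 0 v; rewrite !scale0r addr0 !mul0r addr0. Qed.

Lemma hermZl a u v : herm (a *: u) v = a * herm u v.
Proof. by have := hermPl a 0 u 0 v; rewrite scale0r addr0 mul0r addr0. Qed.

Lemma hermZr a u v : herm u (a *: v) = herm u v * star a.
Proof. by rewrite hermC hermZl starM -hermC. Qed.

Lemma star0 : star (0 : F) = 0.
Proof. by apply: (addrI (star 0)); rewrite -starD !addr0. Qed.

Lemma line_orthE u v : proj_orth (line u) (line v) <-> herm_orth u v.
Proof.
split=> [[u' [v' [/line_scale[a ->] /line_scale[b ->] uv]]]|uv].
  by rewrite /herm_orth hermZl hermZr uv mul0r mulr0.
by exists u, v.
Qed.

Lemma proj_orth_sym (p q : proj) : proj_orth p q -> proj_orth q p.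
Proof.
move=> [u [v [-> -> uv]]]; apply/line_orthE.
by rewrite /herm_orth hermC uv star0.
Qed.

Lemma proj_orth_self (p : proj) : proj_orth p p <-> p = line 0.
Proof.
have [u ->] := projE p; split; first by move/line_orthE/herm_aniso ->.
by move=> ->; apply/line_orthE; exact: herm0l.
Qed.

Lemma proj_orth0x (p : proj) : proj_orth (line 0) p.
Proof. by have [u ->] := projE p; apply/line_orthE; exact: herm0l. Qed.

HB.instance Definition _ :=
  IsOrthoset.Build proj proj_orth_sym proj_orth_self proj_orth0x.

End HermitianTheory.

Definition adjointable (F : starSfieldType) (H1 H2 : hermitianSpaceType F)
    (phi : {linear H1 -> H2}) : Prop :=
  forall rho : H2 -> F, dual_space rho -> dual_space (rho \o phi).

Section ProjMap.
Variables (F : starSfieldType) (H1 H2 : hermitianSpaceType F).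
Variable phi : {linear H1 -> H2}.

Lemma image_span1 (u : H1) : phi @` span1 u = span1 (phi u).
Proof.
apply/seteqP; split=> [_ [_ [a _ <-] <-]|_ [a _ <-]].
  by exists a => //; rewrite linearZ.
by exists (a *: u); [exists a|rewrite linearZ].
Qed.

Lemma image_projP (p : proj H1) : exists v, phi @` p = span1 v.
Proof.
by have [u ->] := projE p; exists (phi u); rewrite image_span1.
Qed.

Definition proj_map (p : proj H1) : proj H2 := Proj (image_projP p).

Lemma proj_map_line (u : H1) : proj_map (line u) = line (phi u).
Proof. by apply: proj_eq; exact: image_span1. Qed.

End ProjMap.

(* Main.v *)
Require Import Defs.
From mathcomp Require Import all_boot all_algebra.
From mathcomp Require Import boolp classical_sets.

(** The dual space consists exactly of the functionals [(., v)]: if [ker rho] is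
    orthoclosed and proper, it has a nonzero orthogonal vector [u], and every
    [x] differs from a multiple of [u] by an element of [ker rho].  Hence the
    adjoint condition says that [{x | phi x _|_ v}] is of the form [w^perp] for
    every [v], which is exactly what the adjoint of the projective map
    provides: linearity of an adjoint never has to be established. *)

Set Implicit Arguments.
Unset Strict Implicit.
Unset Printing Implicit Defensive.

Local Open Scope classical_set_scope.
Local Open Scope ring_scope.

Import GRing.Theory.

Section DualSpace.
Variables (F : starSfieldType) (H : hermitianSpaceType F).
Implicit Types u v : H.

Lemma herm_orth_sym u v : herm_orth u v -> herm_orth v u.
Proof. by rewrite /herm_orth => uv; rewrite Defs.hermC uv star0. Qed.

Lemma herm0r u : herm u (0 : H) = 0.
Proof. by rewrite Defs.hermC herm0l star0. Qed.

(** The vector [v] itself lies in the orthocomplement of this set. *)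
Lemma orthoclosed_orthocompl1 v : orthoclosed [set u : H | herm u v = 0].
Proof.
apply/seteqP; split=> [u uv w wv|u]; first exact/herm_orth_sym/wv.
by apply=> w; exact: herm_orth_sym.
Qed.

Lemma scalar_herm v : scalar (fun u : H => herm u v).
Proof. by move=> a x y; have := hermPl a 1 x y v; rewrite scale1r mul1r. Qed.

Lemma dual_spaceP (rho : H -> F) :
  dual_space rho <-> exists v, rho = fun u => herm u v.
Proof.
split=> [[rho_lin rho_cl]|[v ->]]; last first.
  by split; [exact: scalar_herm|exact: orthoclosed_orthocompl1].
have rho0 : rho 0 = 0.
  by have := rho_lin (-1) 0 0; rewrite scaler0 addr0 mulN1r addNr.
pose K := [set u | rho u = 0].
have [K0|/existsNP[u /not_implyP[Ku /eqP u0]]] :=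
    pselect (forall u, orthocompl K u -> u = 0).
  (* Here [K] equals its double orthocomplement, the whole space, so [rho] vanishes. *)
  exists 0; apply/funext => x; rewrite herm0r.
  suff: K x by [].
  by rewrite /K rho_cl => w /K0 ->; exact: herm0r.
have uu0 : herm u u != 0 by apply: contraNN u0 => /eqP/herm_aniso ->.
have rhou : rho u \is a GRing.unit.
  by apply: sfield_unit; apply: contraNN uu0 => /eqP /Ku ->.
have uuU := sfield_unit _ uu0.
(* The scalar is forced by evaluating [rho] at [u], as the form is star-linear on the right. *)
exists (star ((herm u u)^-1 * rho u) *: u); apply/funext => x.
pose c := rho x / rho u.
have Kx : K (- c *: u + x).
  by rewrite /K /= rho_lin mulNr /c divrK // addNr.
have := herm_orth_sym (Ku _ Kx).
rewrite /herm_orth scalar_herm mulNr addrC => /subr0_eq xu.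
by rewrite hermZr starK xu mulrA mulrK // /c divrK.
Qed.

Lemma orth_lineE u v : orth (line u) (line v) <-> herm u v = 0.
Proof. exact: line_orthE. Qed.

End DualSpace.

Theorem theorem3p23 (F : starSfieldType) (H1 H2 : hermitianSpaceType F)
    (phi : {linear H1 -> H2}) :
  adjointable phi <-> orthoset_adjointable (proj_map phi).
Proof.
split=> [phi_adj|[g gP] rho /dual_spaceP[v ->]].
  have adj (q : proj H2) :
      exists p : proj H1, forall x, orth (proj_map phi x) q <-> orth x p.
    have [v ->] := projE q.
    have /phi_adj/dual_spaceP[w vw] : dual_space (fun u : H2 => herm u v).
      by apply/dual_spaceP; exists v.
    exists (line w) => x; have [u ->] := projE x; rewrite proj_map_line.
    rewrite !orth_lineE.
    by have /= -> := congr1 (fun f => f u) vw.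
  (* The lines are chosen independently for each [q]. *)
  by have [g gP] := choice adj; exists g => x y; exact: gP.
split=> [a x y|]; first by rewrite /= linearP scalar_herm.
(* Any spanning vector [w] will do: only the kernel of the composite matters, and it depends on the
   line alone. *)
have [w gv] := projE (g (line v)).
suff -> : [set u | ((fun y => herm y v) \o phi) u = 0] =
          [set u | herm u w = 0] by exact: orthoclosed_orthocompl1.
apply/funext => u; apply/propext => /=.
by have := gP (line u) (line v); rewrite gv proj_map_line !orth_lineE.
Qed.
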